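(* Let $\mathcal P$ be an additive induced-hereditary hypergraph property and $n=dec(\mathcal P)$. If $\mathcal P_1\circ\cdots\circ\mathcal P_n=\mathcal Q_1\circ\cdots\circ\mathcal Q_n=\mathcal P$ are two factorisations of $\mathcal P$ into $n$ indecomposable additive induced-hereditary properties, then after relabelling the $\mathcal Q_i$'s we have $\mathcal P_i=\mathcal Q_i$ for all $i$; that is, $\mathcal P$ has only one factorisation with exactly $dec(\mathcal P)$ indecomposable factors.
   Context: All hypergraphs are finite, without loops or multiple edges; each edge is an ordered tuple $(v_1,\dots,v_r;c)$ of $r\ge 2$ distinct vertices together with a colour $c$, and isomorphisms must preserve the order and colour of edges. For $U\subseteq V(H)$, $H[U]$ is the hypergraph on $U$ whose edges are those edges of $H$ all of whose vertices lie in $U$; $G\le H$ means $G$ is isomorphic to $H[U]$ for some $U\subseteq V(H)$. A property is a nonempty isomorphism-closed class of hypergraphs; the null hypergraph $K_0$ is regarded as belonging to every property. A property is induced-hereditary if closed under $\le$, and additive if closed under disjoint unions. For properties $\mathcal P_1,\dots,\mathcal P_n$, a $(\mathcal P_1,\dots,\mathcal P_n)$-partition of $H$ is a partition $(V_1,\dots,V_n)$ of $V(H)$ into possibly empty parts with $H[V_i]\in\mathcal P_i$; $\mathcal P_1\circ\cdots\circ\mathcal P_n$ is the class of hypergraphs having such a partition. For hypergraphs $G_1,\dots,G_n$ on pairwise disjoint vertex sets, $G_1*\cdots*G_n$ is the set of all hypergraphs $H$ with $V(H)=\bigcup_i V(G_i)$ and $H[V(G_i)]=G_i$ for all $i$.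 $kG$ is the disjoint union of $k$ copies of $G$; $K_1$ is the one-vertex hypergraph. A $\mathcal P$-decomposition of $G$ with $n$ parts is a partition $(V_1,\dots,V_n)$ of $V(G)$ into nonempty sets such that $kG[V_1]*\cdots*kG[V_n]\subseteq\mathcal P$ for every positive integer $k$. $dec_{\mathcal P}(G)$ is the maximum number of parts in a $\mathcal P$-decomposition of $G$ ($0$ if $G\notin\mathcal P$). $G$ is $\mathcal P$-strict if $G\in\mathcal P$ but $G*K_1\not\subseteq\mathcal P$. $dec(\mathcal P)=\min\{dec_{\mathcal P}(G): G\text{ is }\mathcal P\text{-strict}\}$, and $\mathcal P$ is indecomposable if $dec(\mathcal P)=1$. *)

(* Defs.v *)
From HB Require Import structures.
From mathcomp Require Import all_boot all_fingroup.
From mathcomp Require Import boolp classical_sets functions cardinality.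

Set Implicit Arguments.
Unset Strict Implicit.
Unset Printing Implicit Defensive.

Local Open Scope classical_set_scope.

(* An edge (v_1, ..., v_r; c) is the pair ([:: v_1; ...; v_r], c).  The edges
   form a set of such pairs, so no edge is repeated; the arity r may vary from
   edge to edge.  The colour type is arbitrary, possibly infinite, hence the
   explicit finiteness of the edge set. *)
Record hypergraph (C : Type) := Hypergraph {
  vert :> finType;
  edges : set (seq vert * C);
  edges_finite : finite_set edges;
  edges_wf : forall e, edges e -> (2 <= size e.1) && uniq e.1
}.
Arguments edges {C} h _.
Arguments edges_finite {C} h.

Definition emap (C T U : Type) (f : T -> U) (e : seq T * C) : seq U * C :=
  (map f e.1, e.2).

Definition hiso (C : Type) (G H : hypergraph C) : Prop :=
  exists f : G -> H,
    bijective f /\ forall e, edges G e <-> edges H (emap f e).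

Section Constructions.
Variable C : Type.
Implicit Types G H : hypergraph C.

Lemma emap_inj (T U : Type) (f : T -> U) :
  injective f -> injective (@emap C T U f).
Proof.
by move=> f_inj [s c] [t d] [/(inj_map f_inj) /= -> /= ->].
Qed.

Lemma edgeless_finite (T : finType) : finite_set (@set0 (seq T * C)).
Proof. exact: finite_set0. Qed.

Lemma edgeless_wf (T : finType) (e : seq T * C) :
  set0 e -> (2 <= size e.1) && uniq e.1.
Proof. by []. Qed.

Definition edgeless (T : finType) : hypergraph C :=
  Hypergraph (edgeless_finite T) (@edgeless_wf T).

Definition K0 : hypergraph C := edgeless void.
Definition K1 : hypergraph C := edgeless unit.

Section Induced.
Variables (H : hypergraph C) (U : {set H}).

Definition induced_edges : set (seq {x : H | x \in U} * C) :=
  emap val @^-1` edges H.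

Lemma induced_finite : finite_set induced_edges.
Proof.
apply: finite_preimage (edges_finite H).
by move=> x y _ _; apply: emap_inj; apply: val_inj.
Qed.

Lemma induced_wf e : induced_edges e -> (2 <= size e.1) && uniq e.1.
Proof.
by move=> /edges_wf; rewrite /= size_map map_inj_uniq //; apply: val_inj.
Qed.

Definition induced : hypergraph C := Hypergraph induced_finite induced_wf.
End Induced.

Section DisjointUnion.
Variables G H : hypergraph C.

Definition dunion_edges : set (seq (G + H)%type * C) :=
  emap inl @` edges G `|` emap inr @` edges H.

Lemma dunion_finite : finite_set dunion_edges.
Proof.
by rewrite finite_setU; split; apply: finite_image; apply: edges_finite.
Qed.

Lemma dunion_wf e : dunion_edges e -> (2 <= size e.1) && uniq e.1.
Proof.
case=> -[e' /edges_wf we <-]; rewrite /= size_map map_inj_uniq //.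
- exact: inl_inj.
- exact: inr_inj.
Qed.

Definition dunion : hypergraph C := Hypergraph dunion_finite dunion_wf.
End DisjointUnion.

Definition copies (k : nat) G : hypergraph C := iter k (dunion G) K0.

End Constructions.

Arguments K0 {C}.
Arguments K1 {C}.

Definition hle (C : Type) (G H : hypergraph C) : Prop :=
  exists U : {set H}, hiso G (induced U).

(* Partition into parts indexed by I; parts may be empty. *)
Definition opartition (T I : finType) (U : I -> {set T}) : Prop :=
  (forall i j, i != j -> [disjoint U i & U j]%B) /\
  (forall x, exists i, x \in U i).

(* Not [set (hypergraph C)]: the universe of [set] is below that of [finType]. *)
Definition hclass (C : Type) := hypergraph C -> Prop.

(* The members of the join of the G i, up to isomorphism: since the vertex
   sets of the G i are unrelated types, each G i is identified with an
   isomorphic copy of it inside H. *)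
Definition join (C : Type) (I : finType) (G : I -> hypergraph C) : hclass C :=
  fun H => exists U : I -> {set H},
    opartition U /\ forall i, hiso (induced (U i)) (G i).

Definition join2 (C : Type) (G H : hypergraph C) : hclass C :=
  join (fun b : bool => if b then G else H).

(* Nonemptiness follows from K0 being a member. *)
Definition is_property (C : Type) (P : hclass C) : Prop :=
  P K0 /\ forall G H, hiso G H -> P G -> P H.

Definition induced_hereditary (C : Type) (P : hclass C) : Prop :=
  forall G H, hle G H -> P H -> P G.

Definition additive (C : Type) (P : hclass C) : Prop :=
  forall G H, P G -> P H -> P (dunion G H).

Definition additive_ih_property (C : Type) (P : hclass C) : Prop :=
  [/\ is_property P, induced_hereditary P & additive P].

Definition composition (C : Type) (n : nat) (P : 'I_n -> hclass C) : hclass C :=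
  fun H => exists U : 'I_n -> {set H},
    opartition U /\ forall i, P i (induced (U i)).

Definition decomposition (C : Type) (P : hclass C)
    (G : hypergraph C) (n : nat) (U : 'I_n -> {set G}) : Prop :=
  [/\ opartition U,
      forall i, U i != finset.set0 &
      forall k, 0 < k ->
        forall H, join (fun i => copies k (induced (U i))) H -> P H].

(* A partition of the vertices of G into nonempty parts has at most #|G|
   parts, so the range of m below is no restriction. *)
Definition dec_of (C : Type) (P : hclass C) (G : hypergraph C) : nat :=
  if `[< P G >] then
    \max_(m < #|G|.+1 | `[< exists U : 'I_m -> {set G}, decomposition P U >]) m
  else 0.

Definition strict (C : Type) (P : hclass C) (G : hypergraph C) : Prop :=
  P G /\ ~ (forall H, join2 G K1 H -> P H).

(* dec P = n, as a relation: the minimum is undefined when no hypergraph is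
   P-strict, i.e., for an induced-hereditary P, when P contains every
   hypergraph. *)
Definition dec_is (C : Type) (P : hclass C) (n : nat) : Prop :=
  (exists2 G, strict P G & dec_of P G = n) /\
  (forall G, strict P G -> n <= dec_of P G).

Definition indecomposable (C : Type) (P : hclass C) : Prop :=
  dec_is P 1.

(* Main.v *)
From mathcomp Require Import boolp classical_sets cardinality.
From mathcomp Require Import all_boot all_fingroup.
Require Import Defs.

Set Implicit Arguments.
Unset Strict Implicit.
Unset Printing Implicit Defensive.

(* Let [S] be P-strict with [dec_P(S) = n], and let [G] contain [S] and have a
   (P_1, ..., P_n)-partition [d].  If every blow-up of [(G, d)] had a
   (Q_1, ..., Q_n)-partition equal to a fixed partition [f] on all its copies of
   [G], then the common refinement of [d] and [f] would be a P-decomposition; as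
   [S] is strict and [dec_P(S) = n], it has at most [n] parts, so [f] is [d] up
   to relabelling.  Substituting blow-ups into one another excludes all other
   [f] at once: some blow-up has in each of its (Q_1, ..., Q_n)-partitions a copy
   of [G] partitioned as by [d].  Hence the parts of [d] match the Q_i.  If no
   permutation [s] satisfied [P_i <= Q_(s i)] for all [i], one could add to [G] a
   witness in some [P_i] against each [s], contradicting this.  The reverse
   inclusions follow by symmetry, because a permutation has finite order. *)

(** * Tuples inside one class of a map, and lifting of tuples along a map *)

Definition const_on (T : eqType) (I : Type) (f : T -> I) (s : seq T) : Prop :=
  {in s &, forall x y, f x = f y}.

Lemma const_on_map (T U : eqType) (I : Type) (g : T -> U) (f : U -> I) s :
  const_on f (map g s) <-> const_on (f \o g) s.
Proof.
split=> [h x y xs ys|h _ _ /mapP[x xs ->] /mapP[y ys ->]]; last exact: h.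
by apply: h; apply: map_f.
Qed.

Lemma map_lift (T : Type) (U : eqType) (f : T -> U) (s : seq U) :
  {in s, forall y, exists x, y = f x} -> exists t, s = map f t.
Proof.
elim: s => [|y s IHs] sf; first by exists [::].
have [x ->] := sf y (mem_head _ _).
have [|t ->] := IHs; last by exists (x :: t).
by move=> z zs; apply: sf; rewrite inE zs orbT.
Qed.

Definition is_inl (T U : Type) (y : T + U) := if y is inl _ then true else false.

(** * Well-formed edges and their transport along vertex maps *)

Section Hypergraphs.
Variable C : Type.
Implicit Types (G H X : hypergraph C) (P : hclass C).

Definition wf_edge (T : eqType) (e : seq T * C) := (2 <= size e.1) && uniq e.1.

Lemma edges_wf_edge G (e : seq G * C) : edges G e -> wf_edge e.
Proof. exact: edges_wf. Qed.

Lemma wf_edge_emap (T U : eqType) (f : T -> U) (e : seq T * C) :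
  wf_edge (emap f e) -> wf_edge e.
Proof. by rewrite /wf_edge /= size_map => /andP[-> /map_uniq]. Qed.

Lemma emap_wf_edge (T U : eqType) (f : T -> U) (e : seq T * C) :
  {in e.1 &, injective f} -> wf_edge e -> wf_edge (emap f e).
Proof. by move=> fi; rewrite /wf_edge /= size_map map_inj_in_uniq. Qed.

Lemma emap_comp (T U V : Type) (f : T -> U) (g : U -> V) (e : seq T * C) :
  emap g (emap f e) = emap (g \o f) e.
Proof. by rewrite /emap /= -map_comp. Qed.

Lemma eq_in_emap (T : eqType) U (f g : T -> U) (e : seq T * C) :
  {in e.1, f =1 g} -> emap f e = emap g e.
Proof. by move=> fg; rewrite /emap; congr (_, _); apply/eq_in_map. Qed.

Lemma emap_id (T : Type) (e : seq T * C) : emap id e = e.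
Proof. by case: e => s c; rewrite /emap map_id. Qed.

Lemma emap_sum (T U : eqType) (e : seq (T + U)%type * C) :
  const_on (@is_inl T U) e.1 ->
  (exists e', e = emap inl e') \/ (exists e', e = emap inr e').
Proof.
case: e => -[|y s] c /= h; first by left; exists ([::], c).
case: y h => z h; [left | right].
  have [|t E] := @map_lift _ _ (@inl T U) (inl z :: s).
    by move=> y /(h _ _ (mem_head _ _)); case: y => // x; exists x.
  by exists (t, c); rewrite /emap /= -E.
have [|t E] := @map_lift _ _ (@inr T U) (inr z :: s).
  by move=> y /(h _ _ (mem_head _ _)); case: y => // x; exists x.
by exists (t, c); rewrite /emap /= -E.
Qed.

(** The entries of an edge are distinct, so its arity is at most [#|T|] and only finitely many
    tuples occur. The colours are bounded separately by [D], as [C] may be infinite. *)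
Lemma finite_wf_edges (T : finType) (E : set (seq T * C)) (D : set C) :
  finite_set D -> (forall e, E e -> wf_edge e /\ D e.2) -> finite_set E.
Proof.
move=> Dfin ED.
have sfin : finite_set [set s : seq T | uniq s]%classic.
  apply: (@sub_finite_set _ _ (\bigcup_(k in [set: 'I_#|T|.+1])
    ((@tval k T) @` [set: k.-tuple T]))%classic).
    move=> s /= us.
    have ks : size s < #|T|.+1 by rewrite ltnS -(card_uniqP us) max_card.
    by exists (Ordinal ks) => //; exists (in_tuple s).
  apply: bigcup_finite; first exact: finite_finset.
  by move=> k _; apply: finite_image; apply: finite_finset.
apply: sub_finite_set (finite_setX sfin Dfin).
by move=> e /ED[/andP[_ ue] De].
Qed.

Lemma finite_colours G : finite_set (snd @` edges G)%classic.
Proof. exact/finite_image/edges_finite. Qed.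

Lemma dunion_edges_inl G H (e : seq G * C) :
  edges (dunion G H) (emap inl e) <-> edges G e.
Proof.
split=> [[] [e' he' E]|he]; last by left; exists e.
  by rewrite -(emap_inj (@inl_inj _ _) E).
by have := edges_wf_edge he'; case: e' e E {he'} => -[|? ?] c [[|? ?] c'].
Qed.

Lemma dunion_edges_inr G H (e : seq H * C) :
  edges (dunion G H) (emap inr e) <-> edges H e.
Proof.
split=> [[] [e' he' E]|he]; last by right; exists e.
  by have := edges_wf_edge he'; case: e' e E {he'} => -[|? ?] c [[|? ?] c'].
by rewrite -(emap_inj (@inr_inj _ _) E).
Qed.

Lemma emb_hle G H (f : G -> H) : injective f ->
  (forall e, wf_edge e -> edges G e <-> edges H (emap f e)) -> hle G H.
Proof.
move=> fi fE; exists (f @: [set: G])%SET.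
have fU x : f x \in (f @: [set: G])%SET by apply: imset_f; rewrite inE.
exists (fun x => exist _ (f x) (fU x)); split.
  apply: inj_card_bij => [x y [/fi//]|].
  by rewrite card_sig card_imset // cardsT.
move=> e; rewrite /= /induced_edges /preimage /= emap_comp.
split=> [he|he]; first by apply/(fE e (edges_wf_edge he)).
by apply/fE => //; apply: wf_edge_emap (edges_wf_edge he).
Qed.

(** * Closure of induced-hereditary and additive properties *)

Section Hereditary.
Variable P : hclass C.
Hypothesis Ph : induced_hereditary P.

Lemma hereditary_emb G H (f : G -> H) : injective f ->
  (forall e, wf_edge e -> edges G e <-> edges H (emap f e)) -> P H -> P G.
Proof. by move=> fi fE; apply: Ph; apply: emb_hle fE. Qed.

Lemma hereditary_sub G H (U : {set G}) (V : {set H}) (f : G -> H) :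
  {in U &, injective f} -> {in U, forall x, f x \in V} ->
  (forall e, wf_edge e -> {subset e.1 <= U} ->
     edges G e <-> edges H (emap f e)) ->
  P (induced V) -> P (induced U).
Proof.
move=> fi fU fE.
pose g (x : {x | x \in U}) : {y | y \in V} := exist _ (f (val x)) (fU _ (valP x)).
apply: (@hereditary_emb (induced U) (induced V) g).
  by move=> x y [/(fi _ _ (valP x) (valP y)) /val_inj].
move=> e we; rewrite /= /induced_edges /preimage /= emap_comp.
have -> : emap (val \o g) e = emap f (emap val e) by rewrite emap_comp.
apply: fE; first by apply: emap_wf_edge we => x y _ _ /val_inj.
by move=> _ /mapP[x _ ->]; apply: valP.
Qed.

(** Any choice of [g]-preimages in [V] embeds [induced U] into [induced V]. This form serves when
    the natural vertex map starts from the hypergraph already known to satisfy [P]. *)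
Lemma hereditary_cover G H (U : {set G}) (V : {set H}) (g : H -> G) :
  {in U, forall x, exists2 y, y \in V & g y = x} ->
  (forall e, wf_edge (emap g e) -> {subset e.1 <= V} ->
     edges G (emap g e) <-> edges H e) ->
  P (induced V) -> P (induced U).
Proof.
move=> gU gE.
have /choice[f fP] (x : {x | x \in U}) : exists y : {y | y \in V}, g (val y) = val x.
  by have [y yV <-] := gU _ (valP x); exists (exist _ y yV).
apply: (@hereditary_emb (induced U) (induced V) f).
  by move=> x y fxy; apply: val_inj; rewrite -!fP fxy.
move=> e we; rewrite /= /induced_edges /preimage /= emap_comp.
have eE : emap val e = emap g (emap (val \o f) e).
  by rewrite emap_comp; apply: eq_in_emap => x _ /=; rewrite fP.
rewrite eE; apply: gE; last by move=> _ /mapP[x _ ->]; apply: valP.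
by rewrite -eE; apply: emap_wf_edge we => x y _ _ /val_inj.
Qed.

Lemma hereditary_inducedT G : P (induced [set: G]%SET) <-> P G.
Proof.
split; last first.
  apply: (@hereditary_emb (induced [set: G]%SET) G val) => // x y; exact: val_inj.
have gT x : x \in [set: G]%SET by rewrite inE.
apply: (@hereditary_emb G (induced [set: G]%SET) (fun x => exist _ x (gT x))).
  by move=> x y [].
by move=> e _; rewrite /= /induced_edges /preimage /= emap_comp emap_id.
Qed.

Lemma hereditary_empty G (U : {set G}) : P K0 -> U = finset.set0 -> P (induced U).
Proof.
move=> P0 U0.
have F (x : {x | x \in U}) : False by case: x => x; rewrite U0 inE.
apply: (@hereditary_emb (induced U) K0 (fun x => match F x with end)) => //.
by move=> [[//|x s] c] _; case: (F x).
Qed.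

End Hereditary.

(** Induction over the values of [f]: no edge inside [U] joins different fibres, so adding the fibre
    of [a] to the earlier ones amounts to a disjoint union. *)
Lemma additive_fibers P G (U : {set G}) (A : finType) (f : G -> A) :
  additive_ih_property P ->
  (forall e, edges G e -> {subset e.1 <= U} -> const_on f e.1) ->
  (forall a, P (induced [set x in U | f x == a]%SET)) -> P (induced U).
Proof.
move=> [[P0 _] Ph Pa] fE fP.
suff main (s : seq A) : P (induced [set x in U | f x \in s]%SET).
  have := main (enum A); congr (P (induced _)).
  by apply/setP=> x; rewrite !inE mem_enum andbT.
elim: s => [|a s IHs].
  by apply: hereditary_empty => //; apply/setP=> x; rewrite !inE andbF.
have [as_|as_] := boolP (a \in s).
  move: IHs; congr (P (induced _)); apply/setP=> x; rewrite !inE.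
  by case: eqP => [->|//]; rewrite as_.
pose V1 := [set x in U | f x == a]%SET.
pose V2 := [set x in U | f x \in s]%SET.
pose H := dunion (induced V1) (induced V2).
pose g (y : H) : G := match y with inl z => val z | inr z => val z end.
set W := [set x in U | _]%SET.
have PH : P (induced [set: H]%SET).
  exact/(hereditary_inducedT Ph)/(Pa _ _ (fP a) IHs).
apply: (@hereditary_cover P Ph G H W [set: H]%SET g) PH.
  move=> x; rewrite !inE => /andP[xU /orP[xa|xs]].
    have xV : x \in V1 by rewrite inE xU.
    by exists (inl (exist _ x xV)); rewrite ?inE.
  have xV : x \in V2 by rewrite inE xU.
  by exists (inr (exist _ x xV)); rewrite ?inE.
move=> e we _; split; last first.
  by case=> -[e' he' <-]; rewrite emap_comp.
move=> he.
have gU (y : H) : g y \in U.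
  by case: y => -[x /=]; rewrite inE => /andP[].
have ec : const_on (f \o g) e.1.
  by apply/const_on_map; apply: (fE _ he) => _ /mapP[y _ ->].
(* Since [a] is not in [s], the value of [f] tells the two summands apart, so an edge with constant
   [f] stays in one of them. *)
have g_inl (y : H) : (f (g y) == a) = is_inl y.
  case: y => -[x /=]; rewrite inE => /andP[_]; first by [].
  by move=> xs; apply: contraNF as_ => /eqP <-.
have /emap_sum[] : const_on (@is_inl _ _) e.1.
  by move=> x y xs ys; rewrite -!g_inl [f _](ec _ _ xs ys).
  by move=> [e' E]; left; exists e'; rewrite ?E //; move: he; rewrite E emap_comp.
by move=> [e' E]; right; exists e'; rewrite ?E //; move: he; rewrite E emap_comp.
Qed.

End Hypergraphs.

(** * Colourings, strict hypergraphs and decompositions *)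

Section Decompositions.
Variable C : Type.
Implicit Types (G H X S : hypergraph C) (P : hclass C).

(** [copies] is an iterated sum type; a copy number and a position in [G] for each vertex bring it
    into the form that [good] works with. *)
Lemma copies_coordinates k G :
  exists h : copies k G -> 'I_k * G, injective h /\
    forall e, wf_edge e -> edges (copies k G) e <->
      const_on (fst \o h) e.1 /\ edges G (emap (snd \o h) e).
Proof.
elim: k => [|k [h [hi hE]]].
  by exists (fun x : void => match x with end); split=> [[]|[[|[]]]].
pose h' (y : copies k.+1 G) : 'I_k.+1 * G :=
  match y with inl x => (ord0, x) | inr z => (lift ord0 (h z).1, (h z).2) end.
exists h'; split.
  move=> [x|x] [y|y] //=; first by case=> ->.
  case=> E1 E2; congr inr; apply: hi; apply: injective_projections => //.
  exact: val_inj.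
move=> e we; split.
  case=> -[e' he' E]; rewrite -E in we *; rewrite emap_comp; split=> //.
  - by apply/const_on_map.
  - by move: he'; congr (edges G _); rewrite -[LHS]emap_id.
  - apply/const_on_map => x y xs ys /=.
    have /(hE _ (wf_edge_emap we))[hc _] := he'.
    by congr lift; apply: hc.
  - by have /(hE _ (wf_edge_emap we))[] := he'.
case=> hc he.
have /emap_sum[] : const_on (@is_inl _ _) e.1.
  move=> x y xs ys; have := hc _ _ xs ys.
  by case: x {xs} => x; case: y {ys} => y //= /eqP; rewrite -val_eqE.
  move=> [e' E]; rewrite E in we hc he *; left; exists e' => //.
  by move: he; rewrite emap_comp; congr (edges G _); rewrite -[RHS]emap_id.
move=> [e' E]; rewrite E in we hc he *; right; exists e' => //.
apply/(hE _ (wf_edge_emap we)); split; last by move: he; rewrite emap_comp.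
move/const_on_map: hc => hc x y xs ys /=.
by apply: (@lift_inj _ ord0); apply: hc.
Qed.

(** A partition into possibly empty parts, encoded as a map: maps restrict by composition, and
    pairing two of them gives their common refinement. *)
Definition colouring n (Qs : 'I_n -> hclass C) G (c : G -> 'I_n) : Prop :=
  forall i, Qs i (induced [set x | c x == i]).

Lemma composition_colouring n (Qs : 'I_n -> hclass C) G :
  composition Qs G <-> exists c : G -> 'I_n, colouring Qs c.
Proof.
split=> [[U [[Ud Uc] UQ]]|[c cQ]]; last first.
  exists (fun i => [set x | c x == i]); split=> //; split=> [i j ij|x].
    rewrite -setI_eq0; apply/eqP/setP => x; rewrite !inE.
    by apply/negP => /andP[/eqP-> /eqP E]; rewrite E eqxx in ij.
  by exists (c x); rewrite inE.
have [c cU] := choice Uc; exists c => i; move: (UQ i).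
congr (Qs i (induced _)); apply/setP => x; rewrite inE.
apply/idP/eqP => [xi|<-//]; apply/eqP; apply: contraT => ci.
by have := disjointFr (Ud _ _ ci) (cU x); rewrite xi.
Qed.

(** A member of the join of [G] and [K1] outside [P] gets explicit vertices: [q None] is the added
    one, and the edges through it are arbitrary. *)
Lemma strict_extension P G : strict P G ->
  exists H, ~ P H /\ exists q : option G -> H, bijective q /\
    forall e, edges G e <-> edges H (emap (q \o Some) e).
Proof.
case=> _ nP; apply: contrapT => nH; apply: nP => H [U [[Ud Uc] Ui]].
apply: contrapT => nPH; apply: nH; exists H; split=> //.
have /= [ft [[gt ftK gtK] ftE]] := Ui true.
have /= [fb [[gb fbK gbK] _]] := Ui false.
pose q (o : option G) : H := if o is Some x then val (gt x) else val (gb tt).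
have qi : injective q.
  have tb x : val (gt x) != val (gb tt).
    apply/negP => /eqP E; have := disjointFr (Ud true false isT) (valP (gt x)).
    by rewrite E (valP (gb tt)).
  move=> [x|] [y|] //= E.
  - by congr Some; apply: (can_inj gtK); apply: val_inj.
  - by case/eqP: (tb x).
  - by case/eqP: (tb y).
have /choice[r rK] y : exists o, q o = y.
  have [[] yU] := Uc y.
    by exists (Some (ft (exist _ y yU))); rewrite /= ftK.
  exists None; rewrite /= -[y]/(val (exist _ y yU : induced (U false))).
  by rewrite -[in RHS](fbK (exist _ y yU)); case: (fb _).
exists q; split; first by exists r => // o; apply: qi.
move=> e; rewrite -(emap_comp gt val).
have -> : edges H (emap val (emap gt e)) <-> edges (induced (U true)) (emap gt e) by [].
by rewrite ftE emap_comp (@eq_in_emap _ _ _ _ id) ?emap_id // => x _ /=.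
Qed.

(** If class [j] were empty, the added vertex of an extension of [S] outside [P] could form class
    [j] alone, as [Qs j] contains [K1]; the extension would then lie in [P]. *)
Lemma colouring_surj n P (Qs : 'I_n -> hclass C) S (c : S -> 'I_n) :
  (forall i, additive_ih_property (Qs i) /\ Qs i K1) ->
  composition Qs = P -> strict P S -> colouring Qs c ->
  forall j, exists x, c x = j.
Proof.
move=> Qh QP Sst cQ j; apply: contrapT => nj.
have [H [nPH [q [[r rK qK] qE]]]] := strict_extension Sst.
apply: nPH; rewrite -QP; apply/composition_colouring.
exists (fun y => oapp c j (r y)) => i.
have [[_ Qi _] Q1] := Qh i.
have [->|ij] := eqVneq i j.
  have yN (y : {y | y \in [set y | oapp c j (r y) == j]}) : val y = q None.
    case: y => y /=; rewrite inE => /eqP; rewrite -{2}(qK y); case: (r y) => [x|//] /= E.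
    by case: nj; exists x.
  have ind x y : x = y :> {y | y \in [set y | oapp c j (r y) == j]}.
    by apply: val_inj; rewrite !yN.
  have [[_ Qj _] Qj1] := Qh j.
  apply: (@hereditary_emb _ _ Qj _ K1 (fun=> tt)) Qj1 => // -[[|x [|y s]] d] //=.
  by rewrite /wf_edge /= (ind x y) inE eqxx.
apply: (hereditary_cover Qi (g := q \o Some)) (cQ i).
  move=> y; rewrite inE -{2}(qK y); case: (r y) => [x|] /=; last first.
    by rewrite eq_sym (negPf ij).
  by exists x; rewrite ?inE.
by move=> e _ _; rewrite qE.
Qed.

(* The classes of [w] form a P-decomposition: [h] gives each vertex of a member
   of the join its copy number and its position in [G]. *)
Definition good P G (I : Type) (w : G -> I) : Prop :=
  forall (A : finType) H (h : H -> A * G), injective h ->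
    (forall e, wf_edge e -> const_on (w \o snd \o h) e.1 ->
       edges H e <->
         const_on (fst \o h) e.1 /\ edges G (emap (snd \o h) e)) ->
    P H.

(** If the class of [v] missed the copy of [S], the added vertex of an extension of [S] outside [P]
    could be placed at [v]. Every edge through it would leave that class, where [good] imposes no
    condition, so the extension would lie in [P]. *)
Lemma good_meets_strict P S G (I : Type) (w : G -> I) (f : S -> G) :
  strict P S -> injective f ->
  (forall e, wf_edge e -> edges S e <-> edges G (emap f e)) ->
  good P w -> forall v, exists x, w (f x) = w v.
Proof.
move=> Sst fi fE wgood v; apply: contrapT => nv.
have [H [nPH [q [[r rK qK] qE]]]] := strict_extension Sst.
apply: nPH; apply: (wgood unit H (fun y => (tt, oapp f v (r y)))).
  move=> y z [E]; apply: (can_inj qK); move: E.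
  case: (r y) => [a|]; case: (r z) => [b|] //= E.
  - by rewrite (fi _ _ E).
  - by case: nv; exists a; rewrite E.
  - by case: nv; exists b; rewrite -E.
move=> e we wc; have qNe : q None \notin e.1.
  apply/negP => Ne.
  have [y ye yN] : exists2 y, y \in e.1 & y != q None.
    case: e we Ne {wc} => -[//|a [//|b s]] d /andP[_ /= /andP[ab _]] _.
    have [E|] := eqVneq a (q None); last by exists a; rewrite ?mem_head.
    exists b; first by rewrite !inE eqxx orbT.
    by apply: contraNneq ab => ->; rewrite E mem_head.
  have := wc _ _ ye Ne; rewrite /= rK /=; case E: (r y) => [x|] /= wx.
    by case: nv; exists x.
  by move: yN; rewrite -E qK eqxx.
have [e' E] : exists e', e = emap (q \o Some) e'.
  have [|t E] := @map_lift _ _ (q \o Some) e.1.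
    move=> y ye; case E: (r y) => [x|]; first by exists x; rewrite /= -E qK.
    by move: qNe; rewrite -E qK ye.
  by exists (t, e.2); rewrite /emap /= -E; case: (e).
rewrite E -qE emap_comp (@eq_in_emap _ _ _ _ f); last by move=> x _ /=; rewrite rK.
by rewrite fE ?(wf_edge_emap (f := q \o Some)) -?E //; split=> [|[]].
Qed.

Lemma decomposition_leq P G m (U : 'I_m -> {set G}) :
  P G -> decomposition P U -> m <= dec_of P G.
Proof.
move=> PG Udec; have [[Ud _] Un _] := Udec.
rewrite /dec_of; case: asboolP => // _.
(* One vertex from each part gives [m] distinct vertices, so [m] is in the range of the maximum. *)
have mG : m < #|G|.+1.
  have /choice[x xU] i : exists x, x \in U i by apply/set0Pn.
  rewrite ltnS -[m]card_ord; apply: (leq_card x) => i j E.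
  apply/eqP; apply: contraT => ij.
  by have := disjointFr (Ud _ _ ij) (xU i); rewrite E xU.
apply: (@leq_bigmax_cond _ _ (fun i : 'I_#|G|.+1 => i : nat) (Ordinal mG)).
by apply/asboolP; exists U.
Qed.

Lemma opartition_glue (T I : finType) (B : Type) (V : I -> {set T})
    (h : forall i, {y | y \in V i} -> B) :
  opartition V -> exists g : T -> B, forall i y, g (val y) = h i y.
Proof.
move=> [Vd Vc]; pose ix y := cid (Vc y).
exists (fun y => h (sval (ix y)) (exist _ y (svalP (ix y)))) => i [y yV] /=.
case: (ix y) => j yVj /=.
have E : j = i.
  apply/eqP; apply: contraT => ji.
  by have := disjointFr (Vd _ _ ji) yVj; rewrite yV.
by case: i / E yV => yV; congr h; apply: val_inj.
Qed.

(** The classes of [w] cut [S] into parts, none of them empty by [good_meets_strict]. A member of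
    the join of [k] copies of these parts maps to ['I_k * G] as [good] requires, so the parts form a
    P-decomposition of [S]. *)
Lemma good_card_leq P S G (I : finType) (w : G -> I) (f : S -> G) :
  strict P S -> injective f ->
  (forall e, wf_edge e -> edges S e <-> edges G (emap f e)) ->
  good P w -> #|[set w v | v in [set: G]]| <= dec_of P S.
Proof.
move=> Sst fi fE wgood; have wS := good_meets_strict Sst fi fE wgood.
set D := [set w v | v in _]; pose U (i : 'I_#|D|) := [set x | w (f x) == enum_val i].
apply: (@decomposition_leq _ _ _ U); first by case: Sst.
have xD v : w v \in D by apply: imset_f; rewrite inE.
split; first split.
- move=> i j ij; rewrite -setI_eq0; apply/eqP/setP => x; rewrite !inE.
  by apply/negP => /andP[/eqP-> /eqP/enum_val_inj E]; rewrite E eqxx in ij.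
- by move=> x; exists (enum_rank_in (xD (f x)) (w (f x))); rewrite inE enum_rankK_in.
- move=> i; have /imsetP[v _ vi] := enum_valP i.
  by have [x xv] := wS v; apply/set0Pn; exists x; rewrite inE vi xv.
move=> k _ H [V [Vp Vi]].
have /fin_all_exists[h hP] i : exists h : {y | y \in V i} -> 'I_k * {x | x \in U i},
    injective h /\ forall e, wf_edge e -> edges (induced (V i)) e <->
      const_on (fst \o h) e.1 /\ edges (induced (U i)) (emap (snd \o h) e).
  have [g [gb gE]] := Vi i; have [h [hi hE]] := copies_coordinates k (induced (U i)).
  exists (h \o g); split; first exact: inj_comp hi (bij_inj gb).
  move=> e we; rewrite gE hE; last by apply: emap_wf_edge we => x y _ _; apply: bij_inj.
  rewrite emap_comp.
  by split=> -[hc he]; split=> //; [move/const_on_map: hc | apply/const_on_map].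
pose h' i (y : {y | y \in V i}) := ((h i y).1, f (val (h i y).2)).
have [g gh] := opartition_glue h' Vp.
have [Vd Vc] := Vp.
(* The position in [G] determines the part; this makes the glued map injective and confines an edge
   with constant [w] to one part. *)
have gV i y : y \in V i -> w (g y).2 = enum_val i.
  move=> yV; rewrite (gh i (exist _ y yV)) /=.
  by case: (h i _).2 => x /=; rewrite inE => /eqP.
apply: (wgood _ _ g).
  move=> y z E; have [i yV] := Vc y; have [j zV] := Vc z.
  have ij : i = j by apply: enum_val_inj; rewrite -(gV _ _ yV) -(gV _ _ zV) E.
  rewrite -{j}ij in zV; move: E.
  rewrite (gh i (exist _ y yV)) (gh i (exist _ z zV)) => -[E1 /fi/val_inj E2].
  by have [hi _] := hP i; case: (hi _ _ (injective_projections _ _ E1 E2)).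
move=> e we wc.
have [i eV] : exists i, {subset e.1 <= V i}.
  case: e we wc => -[//|y s] d _ wc; have [i yV] := Vc y; exists i => z zs.
  have [j zV] := Vc z; suff -> : i = j by [].
  apply: enum_val_inj; rewrite -(gV _ _ yV) -(gV _ _ zV).
  exact: (wc _ _ (mem_head _ _) zs).
have [e' E] : exists e' : seq {y | y \in V i} * C, e = emap val e'.
  have [|t E] := @map_lift {y | y \in V i} _ val e.1.
    by move=> y /eV yV; exists (exist _ y yV).
  by exists (t, e.2); rewrite /emap /= -E; case: (e).
have [hi hE] := hP i; rewrite E in we wc *; rewrite emap_comp.
apply: (iff_trans (hE e' (wf_edge_emap we))).
have -> : emap (snd \o g \o val) e' = emap f (emap val (emap (snd \o h i) e')).
  by rewrite !emap_comp; apply: eq_in_emap => y _ /=; rewrite gh.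
split=> -[hc he].
  have heS : edges S (emap val (emap (snd \o h i) e')) := he.
  split; last by apply/fE => //; apply: edges_wf_edge heS.
  by apply/const_on_map => x y xs ys /=; rewrite !gh; apply: hc.
split; last first.
  by apply/(fE (emap val _)) => //; apply: wf_edge_emap (edges_wf_edge he).
by move/const_on_map: hc => hc x y xs ys; have := hc _ _ xs ys; rewrite /= !gh.
Qed.

(** A strict [G] with [dec_of] equal to 1 is not null, since otherwise the maximum would range over
    [m = 0] only; any vertex of [G] then induces [K1]. *)
Lemma indecomposable_K1 P : additive_ih_property P -> indecomposable P -> P K1.
Proof.
move=> [_ Ph _] [[G [PG _] dG] _].
have [x _|G0] := pickP (@predT G); last first.
  move: dG; rewrite /dec_of; case: asboolP => // _.
  by rewrite (eq_card0 G0) big_mkcond big_ord1 /=; case: ifP.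
apply: (hereditary_emb Ph (f := fun=> x)) PG; first by case=> -[].
move=> [[|[] [|[] s]] d] //.
Qed.

End Decompositions.

(** * Blow-ups of a partitioned hypergraph *)

Section Blowups.
Variables (C : Type) (n : nat).
Implicit Types (G H X S : hypergraph C) (P : hclass C).

(* A member of [kG[V_1] * ... * kG[V_n]], where [V_i] is the class [i] of [d],
   with the copies of the parts aligned so that it contains [k] copies of [G]. *)
Record blowup G (d : G -> 'I_n) := Blowup {
  copy : finType;
  bedges : set (seq (copy * G) * C);
  bfinite : finite_set bedges;
  bwf : forall e, bedges e -> wf_edge e;
  bpart : forall e, wf_edge e -> const_on (d \o snd) e.1 ->
    bedges e <-> const_on fst e.1 /\ edges G (emap snd e);
  bcopy : forall e, wf_edge e -> const_on fst e.1 ->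
    bedges e <-> edges G (emap snd e)
}.

Definition bhyp G (d : G -> 'I_n) (B : blowup d) : hypergraph C :=
  Hypergraph (@bfinite G d B) (@bwf G d B).

(** An edge inside one class of [d] stays in one copy, so class [i] of the blow-up is a disjoint
    union of copies of class [i] of [G], and additivity applies. *)
Lemma blowup_colouring G (d : G -> 'I_n) (Ps : 'I_n -> hclass C) (B : blowup d) :
  (forall i, additive_ih_property (Ps i)) -> colouring Ps d ->
  colouring Ps (fun x : bhyp B => d x.2).
Proof.
move=> Ph dP i.
apply: (@additive_fibers _ _ (bhyp B) _ (copy B) fst) => //.
  move=> e he eU; have we := edges_wf_edge he.
  have dc : const_on (d \o snd) e.1.
    by move=> x y /eU + /eU; rewrite !inE /= => /eqP-> /eqP->.
  by have /(bpart we dc)[] := he.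
move=> k; have [_ Pi _] := Ph i.
apply: (@hereditary_sub _ _ Pi (bhyp B) _ _ _ snd) (dP i).
- move=> [k1 x] [k2 y]; rewrite !inE /= => /andP[_ /eqP->] /andP[_ /eqP->].
  by move=> ->.
- by move=> x; rewrite !inE => /andP[].
move=> e we eU; apply: (bcopy we).
by move=> x y /eU + /eU; rewrite !inE => /andP[_ /eqP->] /andP[_ /eqP->].
Qed.

Lemma copy_colouring G (d : G -> 'I_n) (Qs : 'I_n -> hclass C) (B : blowup d)
    (c : bhyp B -> 'I_n) k :
  (forall i, additive_ih_property (Qs i)) -> colouring Qs c ->
  colouring Qs (fun v => c (k, v)).
Proof.
move=> Qh cQ i; have [_ Qi _] := Qh i.
apply: (@hereditary_sub _ _ Qi _ (bhyp B) _ _ (pair k)) (cQ i).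
- by move=> x y _ _ [].
- by move=> x; rewrite !inE.
move=> e we _.
have kc : const_on fst (emap (pair k) e).1 by apply/const_on_map.
apply: iff_sym; apply: (iff_trans (@bcopy _ _ B _ _ kc)).
  by apply: emap_wf_edge we => x y _ _ [].
by rewrite emap_comp (@eq_in_emap _ _ _ _ id) ?emap_id.
Qed.

Lemma blowup_trivial G (d : G -> 'I_n) : exists B : blowup d, inhabited (copy B).
Proof.
pose E (e : seq (unit * G) * C) := edges G (emap snd e).
have uc (s : seq (unit * G)) : const_on fst s by move=> [[] x] [[] y].
have Ewf e : E e -> wf_edge e by move=> /edges_wf_edge/wf_edge_emap.
have Efin : finite_set E.
  apply: (finite_wf_edges (finite_colours G)) => e he; split; first exact: Ewf.
  by exists (emap snd e).
have part e : wf_edge e -> const_on (d \o snd) e.1 ->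
    E e <-> const_on fst e.1 /\ edges G (emap snd e).
  by move=> _ _; split=> [|[]].
by exists (Blowup Efin Ewf part (fun e _ _ => iff_refl (E e))); split; exact: tt.
Qed.

(* Each of the [B2]-copies of [G] is replaced by a copy of [B1].  Every choice
   [r] of one [B1]-copy in each of them spans a copy of [B2]. *)
Lemma blowup_product G (d : G -> 'I_n) (B1 B2 : blowup d) :
  exists B : blowup d, exists pr : copy B2 -> copy B1 -> copy B,
    [/\ (forall l k l' k', pr l k = pr l' k' -> l = l' /\ k = k'),
     (forall l e, wf_edge e ->
       bedges e <-> @bedges _ _ B (emap (fun x => (pr l x.1, x.2)) e)) &
     (forall (r : copy B2 -> copy B1) e, wf_edge e ->
       bedges e <-> @bedges _ _ B (emap (fun x => (pr x.1 (r x.1), x.2)) e))].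
Proof.
pose p1 (x : (copy B2 * copy B1) * G) : copy B1 * G := (x.1.2, x.2).
pose p2 (x : (copy B2 * copy B1) * G) : copy B2 * G := (x.1.1, x.2).
(* [lc e] says that the edge stays in one [B2]-copy; such edges are governed by [B1], all others by
   [B2]. *)
pose lc (e : seq ((copy B2 * copy B1) * G) * C) := const_on (fst \o fst) e.1.
pose E (e : seq ((copy B2 * copy B1) * G) * C) :=
  lc e /\ bedges (emap p1 e) \/ ~ lc e /\ bedges (emap p2 e).
have Ewf e : E e -> wf_edge e.
  by case=> -[_ /bwf/wf_edge_emap].
have Efin : finite_set E.
  have Dfin : finite_set (snd @` @bedges _ _ B1 `|` snd @` @bedges _ _ B2)%classic.
    by rewrite finite_setU; split; apply: finite_image; apply: bfinite.
  apply: (finite_wf_edges Dfin) => e he; split; first exact: Ewf.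
  case: he => -[_ he]; [left | right].
    by exists (emap p1 e).
  by exists (emap p2 e).
have p1wf e : wf_edge e -> lc e -> wf_edge (emap p1 e).
  move=> we ec; apply: emap_wf_edge we => -[[l k] x] [[l' k'] x'] xe xe' [<- <-].
  by have /= -> := ec _ _ xe xe'.
have part e : wf_edge e -> const_on (d \o snd) e.1 ->
    E e <-> const_on fst e.1 /\ edges G (emap snd e).
  move=> we dc; have [ec|nec] := pselect (lc e).
    have dc1 : const_on (d \o snd) (emap p1 e).1 by apply/const_on_map.
    have := bpart (p1wf e we ec) dc1; rewrite emap_comp => b1.
    split=> [[[_ /b1[k1 he]]|[]//]|[k1 he]].
      split=> //; move/const_on_map: k1 => k1 x y xs ys.
      by apply: injective_projections; [apply: ec | apply: k1].
    left; split=> //; apply/b1; split=> //; apply/const_on_map => x y xs ys /=.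
    by rewrite (k1 _ _ xs ys).
  split=> [[[]//|[_ he]]|[k1 he]]; last first.
    by case: nec => x y xs ys /=; rewrite (k1 _ _ xs ys).
  case: nec; have dc2 : const_on (d \o snd) (emap p2 e).1 by apply/const_on_map.
  by have /(bpart (bwf he) dc2)[/const_on_map] := he.
have cop e : wf_edge e -> const_on fst e.1 -> E e <-> edges G (emap snd e).
  move=> we k1; have ec : lc e by move=> x y xs ys /=; rewrite (k1 _ _ xs ys).
  have kc : const_on fst (emap p1 e).1.
    by apply/const_on_map => x y xs ys /=; rewrite (k1 _ _ xs ys).
  have := bcopy (p1wf e we ec) kc; rewrite emap_comp => b1.
  by split=> [[[_ /b1]|[]]|/b1] //; left.
exists (Blowup Efin Ewf part cop), pair; split=> [l k l' k' []//|l e we|r e we] /=.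
  set e' := emap _ e.
  have ec : lc e' by apply/const_on_map.
  have E1 : emap p1 e' = e.
    by rewrite emap_comp (@eq_in_emap _ _ _ _ id) ?emap_id // => -[].
  by split=> [he|[[_]|[]//]]; [left | ]; rewrite E1.
set e' := emap _ e.
have E2 : emap p2 e' = e.
  by rewrite emap_comp (@eq_in_emap _ _ _ _ id) ?emap_id // => -[].
have [ec|nec] := pselect (lc e'); last first.
  by split=> [he|[[]//|[_]]]; [right | ]; rewrite E2.
(* The two rules meet here: as [r] depends on the outer copy alone, the edge lies in a single copy
   of [G], where [B1] and [B2] both reproduce [G]. *)
have kc : const_on fst e.1 by move/const_on_map: ec.
have kc' : const_on fst e'.1.
  by apply/const_on_map => x y xs ys /=; rewrite (kc _ _ xs ys).
have we' : wf_edge e' by apply: (wf_edge_emap (f := p2)); rewrite E2.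
apply: (iff_trans (bcopy we kc)); apply: iff_sym.
by apply: (iff_trans (cop _ we' kc')); rewrite emap_comp.
Qed.

(** Induction on [F], through the product of [B1] avoiding the tail and [B2] avoiding the head [f].
    Within each outer copy some inner copy avoids the tail; these choices span a copy of [B2], so
    one of them avoids [f] as well. *)
Lemma blowup_avoid_seq G (d : G -> 'I_n) (Qs : 'I_n -> hclass C)
    (F : seq {ffun G -> 'I_n}) :
  (forall i, additive_ih_property (Qs i)) ->
  {in F, forall f, exists B : blowup d, forall c : bhyp B -> 'I_n,
     colouring Qs c -> exists k, [ffun v => c (k, v)] != f} ->
  exists B : blowup d, forall c : bhyp B -> 'I_n,
     colouring Qs c -> exists k, [ffun v => c (k, v)] \notin F.
Proof.
move=> Qh; elim: F => [|f F IHF] Fbad.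
  by have [B [k]] := blowup_trivial d; exists B => c _; exists k.
have [|B1 B1P] := IHF; first by move=> g gF; apply: Fbad; rewrite inE gF orbT.
have [B2 B2P] := Fbad f (mem_head _ _).
have [B [pr [pri pr1 pr2]]] := blowup_product B1 B2; exists B => c cQ.
have sub (B' : blowup d) (g : bhyp B' -> bhyp B) : injective g ->
    (forall e, wf_edge e -> @bedges _ _ B' e <-> @bedges _ _ B (emap g e)) ->
    colouring Qs (c \o g).
  move=> gi gE i; have [_ Qi _] := Qh i.
  apply: (@hereditary_sub _ _ Qi (bhyp B') (bhyp B) _ _ g) (cQ i).
  - by move=> x y _ _ /gi.
  - by move=> x; rewrite !inE.
  - by move=> e we _; apply: gE.
have /choice[r rF] l : exists k, [ffun v => c (pr l k, v)] \notin F.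
  have [] := B1P (fun x => c (pr l x.1, x.2)); last by move=> k; exists k.
  apply: (sub _ (fun x => (pr l x.1, x.2))) (pr1 l).
  by move=> [k x] [k' x'] [/pri[_ ->] ->].
have [|l lf] := B2P (fun x => c (pr x.1 (r x.1), x.2)).
  apply: (sub _ (fun x => (pr x.1 (r x.1), x.2))) (pr2 r).
  by move=> [k x] [k' x'] [/pri[-> _] ->].
by exists (pr l (r l)); rewrite inE negb_or lf rF.
Qed.


(* A vertex of [H] with class [w] and copy number [a] is placed in copy [(w, a)]
   of the blow-up: vertices in different classes then lie in different copies of
   [G], so edges of [H] between them never clash with the edges of [G]. *)
Lemma blowup_good G (d : G -> 'I_n) (f : G -> 'I_n) (Qs : 'I_n -> hclass C) :
  (forall i, additive_ih_property (Qs i)) ->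
  (forall B : blowup d, exists2 c : bhyp B -> 'I_n,
     colouring Qs c & forall k v, c (k, v) = f v) ->
  good (composition Qs) (fun v => (d v, f v)).
Proof.
move=> Qh cB A H h hi hE.
pose phi (x : H) : ('I_n * 'I_n * A) * G := ((d (h x).2, f (h x).2, (h x).1), (h x).2).
have phii : injective phi.
  by move=> x y [_ _ E1 E2]; apply: hi; apply: injective_projections.
(* Inside a copy the edges are those of [G]; an edge that leaves both its copy and its [d]-class is
   taken from [H]; an edge in one [d]-class but several copies is absent. *)
pose E (e : seq (('I_n * 'I_n * A) * G) * C) := wf_edge e /\
  (const_on fst e.1 /\ edges G (emap snd e) \/
   ~ const_on (d \o snd) e.1 /\ ~ const_on fst e.1 /\
     exists2 e', edges H e' & emap phi e' = e).
have Ewf e : E e -> wf_edge e by case.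
have Efin : finite_set E.
  have Dfin : finite_set (snd @` edges G `|` snd @` edges H)%classic.
    by rewrite finite_setU; split; apply: finite_colours.
  apply: (finite_wf_edges Dfin) => e [we he]; split=> //.
  case: he => [[_ he]|[_ [_ [e' he' <-]]]]; [left | right].
    by exists (emap snd e).
  by exists e'.
have part e : wf_edge e -> const_on (d \o snd) e.1 ->
    E e <-> const_on fst e.1 /\ edges G (emap snd e).
  by move=> we dc; split=> [[_ [//|[]//]]|he]; split=> //; left.
have cop e : wf_edge e -> const_on fst e.1 -> E e <-> edges G (emap snd e).
  by move=> we kc; split=> [[_ [[]//|[_ []//]]]|he]; split=> //; left.
have [c cQ cf] := cB (Blowup Efin Ewf part cop).
apply/composition_colouring; exists (fun x => f (h x).2) => i.
have [_ Qi _] := Qh i.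
apply: (@hereditary_sub _ _ Qi _ (bhyp (Blowup Efin Ewf part cop)) _ _ phi) (cQ i).
- by move=> x y _ _; apply: phii.
- by move=> x; rewrite !inE cf.
move=> e we eU.
have we' : wf_edge (emap phi e) by apply: emap_wf_edge we => x y _ _; apply: phii.
have fc : const_on (fun x => f (h x).2) e.1.
  by move=> x y /eU + /eU; rewrite !inE => /eqP-> /eqP->.
(* Inside a class of [f], an edge across classes of [d] is taken from [H]; one within a class of [d]
   lies in one class of the refinement, where [hE] describes it. *)
have [dc|ndc] := pselect (const_on (fun x => d (h x).2) e.1); last first.
  have ndc' : ~ const_on (d \o snd) (emap phi e).1 by move=> /const_on_map.
  have nk : ~ const_on fst (emap phi e).1.
    by move=> /const_on_map k; apply: ndc => x y xs ys; case: (k _ _ xs ys).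
  split=> [he|]; first by split=> //; right; split=> //; split=> //; exists e.
  by case=> _ [[//]|[_ [_ [e' he' /(emap_inj phii)<-]]]].
have wc : const_on ((fun v => (d v, f v)) \o snd \o h) e.1.
  by move=> x y xs ys /=; rewrite (dc _ _ xs ys) (fc _ _ xs ys).
have dc' : const_on (d \o snd) (emap phi e).1 by apply/const_on_map.
apply: (iff_trans (hE _ we wc)); apply: iff_sym.
apply: (iff_trans (part _ we' dc')); rewrite emap_comp.
split=> -[kc he]; split=> //.
  by move/const_on_map: kc => kc x y xs ys; case: (kc _ _ xs ys).
apply/const_on_map => x y xs ys; rewrite /= (dc _ _ xs ys) (fc _ _ xs ys).
by congr (_, _); apply: kc.
Qed.

End Blowups.

(** * Matching the factors of two factorisations *)

Section Uniqueness.
Variables (C : Type) (n : nat) (P : hclass C) (S : hypergraph C).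
Variables Ps Qs : 'I_n -> hclass C.
Hypothesis Ph : forall i, additive_ih_property (Ps i) /\ Ps i K1.
Hypothesis Qh : forall i, additive_ih_property (Qs i) /\ Qs i K1.
Hypotheses (PsP : composition Ps = P) (QsP : composition Qs = P).
Hypotheses (Sst : strict P S) (Sdec : dec_of P S = n).
Implicit Types G X : hypergraph C.

Let Pa i : additive_ih_property (Ps i) := (Ph i).1.
Let Qa i : additive_ih_property (Qs i) := (Qh i).1.

Section Extension.
Variables (G : hypergraph C) (d : G -> 'I_n) (j : S -> G).
Hypotheses (ji : injective j)
  (jE : forall e, wf_edge e -> edges S e <-> edges G (emap j e)).

Lemma extension_colouring_surj (Rs : 'I_n -> hclass C) (c : G -> 'I_n) :
  (forall i, additive_ih_property (Rs i) /\ Rs i K1) -> composition Rs = P ->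
  colouring Rs c -> forall i, exists v, c v = i.
Proof.
move=> Rh RP cR i.
have [|x <-] := colouring_surj (c := c \o j) Rh RP Sst _ i; last by exists (j x).
move=> k; have [[_ Rk _] _] := Rh k.
apply: (hereditary_sub Rk (f := j)) (cR k).
- by move=> x y _ _ /ji.
- by move=> x; rewrite !inE.
- by move=> e we _; apply: jE.
Qed.

Hypothesis dP : colouring Ps d.

(** The common refinement has at most [n] classes, collected in [D]. Both projections map [D] onto
    ['I_n], hence are injective on it, so [D] is the graph of a permutation. *)
Lemma blowup_recolouring (f : G -> 'I_n) :
  (forall B : blowup d, exists2 c : bhyp B -> 'I_n,
     colouring Qs c & forall k v, c (k, v) = f v) ->
  exists2 s : 'I_n -> 'I_n, injective s & forall v, f v = s (d v).
Proof.
move=> cB; have dsurj := extension_colouring_surj Ph PsP dP.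
have fQ : colouring Qs f.
  have [B [k]] := blowup_trivial d; have [c cQ cf] := cB B.
  have := copy_colouring k Qa cQ; congr (colouring Qs _).
  by apply/funext => v; rewrite cf.
have fsurj := extension_colouring_surj Qh QsP fQ.
have wgood := blowup_good Qa cB; rewrite QsP in wgood.
have := good_card_leq Sst ji jE wgood; rewrite Sdec.
set D := [set _ | _ in _] => Dn.
have vD v : (d v, f v) \in D by apply: imset_f; rewrite inE.
have proj_inj (p : 'I_n * 'I_n -> 'I_n) :
    (forall i, exists v, p (d v, f v) = i) -> {in D &, injective p}.
  move=> psurj; apply/imset_injP; rewrite eqn_leq leq_imset_card /=.
  apply: (leq_trans Dn); rewrite -[X in X <= _]card_ord -cardsT; apply: subset_leq_card.
  by apply/subsetP => i _; have [v <-] := psurj i; apply: imset_f.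
have fst_inj := proj_inj fst dsurj; have snd_inj := proj_inj snd fsurj.
have [u du] := choice dsurj.
exists (fun i => f (u i)) => [i k E|v].
  by move: (snd_inj _ _ (vD (u i)) (vD (u k)) E) => [+ _]; rewrite !du.
by move: (fst_inj _ _ (vD v) (vD (u (d v)))); rewrite /= du => /(_ erefl)[].
Qed.

Lemma extension_matching :
  exists s : {perm 'I_n}, forall i, Qs (s i) (induced [set v | d v == i]).
Proof.
(* Only finitely many maps from [G] to ['I_n] exist, so one blow-up avoids all those that do not
   relabel [d]. *)
pose bad (f : {ffun G -> 'I_n}) :=
  `[< ~ exists2 s : 'I_n -> 'I_n, injective s & forall v, f v = s (d v) >].
have [|B BP] := @blowup_avoid_seq _ _ G d Qs (filter bad (enum {ffun G -> 'I_n})) Qa.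
  move=> f; rewrite mem_filter => /andP[/asboolP fbad _].
  apply: contrapT => nB; apply: fbad; apply: blowup_recolouring => B.
  apply: contrapT => nc; apply: nB; exists B => c cQ.
  apply: contrapT => nk; apply: nc; exists c => // k v.
  have [E|ne] := eqVneq [ffun v => c (k, v)] f; first by rewrite -E ffunE.
  by case: nk; exists k.
have : P (bhyp B).
  by rewrite -PsP; apply/composition_colouring; eexists; apply: blowup_colouring Pa dP.
rewrite -QsP => /composition_colouring[c cQ].
have [k] := BP c cQ; rewrite mem_filter mem_enum andbT => /asboolPn/contrapT[s si sP].
exists (perm si) => i; rewrite permE; have := copy_colouring k Qa cQ (s i).
congr (Qs _ (induced _)); apply/setP => v; rewrite !inE.
by have := sP v; rewrite ffunE => ->; rewrite (inj_eq si).
Qed.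

End Extension.

(** Class [i] becomes the disjoint union of its old part and [X], while the other classes do not
    change. *)
Lemma adjoin G (d : G -> 'I_n) i X : colouring Ps d -> Ps i X ->
  colouring Ps (fun y : dunion G X => match y with inl v => d v | inr _ => i end).
Proof.
move=> dP PX k; have [[P0 _] Pk _] := Pa k.
apply: (@additive_fibers _ _ (dunion G X) _ bool (@is_inl _ _)) => //.
  by move=> e [] [e' _ <-] _; apply/const_on_map.
case.
  apply: (@hereditary_cover _ _ Pk (dunion G X) G _ _ inl) (dP k).
    by move=> [v|x]; rewrite !inE ?andbF // andbT => vk; exists v; rewrite ?inE.
  by move=> e _ _; apply: dunion_edges_inl.
have [E|ik] := eqVneq i k; last first.
  apply: hereditary_empty => //; apply/setP => -[v|x]; rewrite !inE ?andbF //.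
  by rewrite (negPf ik).
rewrite E in PX.
apply: (@hereditary_cover _ _ Pk (dunion G X) X _ [set: X] inr).
- by move=> [v|x]; rewrite !inE ?andbF // => _; exists x; rewrite ?inE.
- by move=> e _ _; apply: dunion_edges_inr.
- exact/(hereditary_inducedT Pk)/PX.
Qed.

Lemma factors_dominated :
  exists s : {perm 'I_n}, forall i X, Ps i X -> Qs (s i) X.
Proof.
apply: contrapT => ns.
have [G [d [j [ji jE dP nQ]]]] : exists G (d : G -> 'I_n) (j : S -> G),
    [/\ injective j, forall e, wf_edge e -> edges S e <-> edges G (emap j e),
      colouring Ps d & {in enum {perm 'I_n}, forall s : {perm 'I_n},
        ~ forall i, Qs (s i) (induced [set v | d v == i])}].
  (* One permutation at a time: a witness against [s] is adjoined to its class, and earlier failures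
     persist because the [Qs] are induced-hereditary. *)
  elim: (enum {perm 'I_n}) => [|s l [G [d [j [ji jE dP nQ]]]]].
    have : P S by case: Sst.
    rewrite -PsP => /composition_colouring[d dP].
    by exists S, d, id; split=> // e _; rewrite emap_id.
  have [i [X [PX nQX]]] : exists i X, Ps i X /\ ~ Qs (s i) X.
    apply: contrapT => nX; apply: ns; exists s => i X PX.
    by apply: contrapT => nQX; apply: nX; exists i, X.
  exists (dunion G X), (fun y => match y with inl v => d v | inr _ => i end), (inl \o j).
  split; first by move=> x y [/ji].
  - move=> e we; apply: (iff_trans (jE e we)); rewrite -(emap_comp j inl).
    by apply: iff_sym; apply: dunion_edges_inl.
  - exact: adjoin.
  move=> t; rewrite inE => /orP[/eqP->|tl] tQ.
    apply: nQX; have [_ Qi _] := Qa (s i).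
    apply/(hereditary_inducedT Qi).
    apply: (@hereditary_sub _ _ Qi X (dunion G X) _ _ inr) (tQ i).
    - by move=> x y _ _ [].
    - by move=> x; rewrite !inE.
    - by move=> e _ _; apply: iff_sym; apply: dunion_edges_inr.
  apply: (nQ t tl) => i'; have [_ Qi _] := Qa (t i').
  apply: (@hereditary_sub _ _ Qi G (dunion G X) _ _ inl) (tQ i').
  - by move=> x y _ _ [].
  - by move=> x; rewrite !inE.
  - by move=> e _ _; apply: iff_sym; apply: dunion_edges_inl.
have [s sQ] := extension_matching ji jE dP.
by apply: (nQ s _ sQ); rewrite mem_enum.
Qed.

End Uniqueness.

Theorem theorem4 (C : Type) (P : hclass C) (n : nat)
    (Ps Qs : 'I_n -> hclass C) :
  additive_ih_property P ->
  dec_is P n ->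
  (forall i, additive_ih_property (Ps i) /\ indecomposable (Ps i)) ->
  (forall i, additive_ih_property (Qs i) /\ indecomposable (Qs i)) ->
  composition Ps = P ->
  composition Qs = P ->
  exists s : {perm 'I_n}, forall i, Ps i = Qs (s i).
Proof.
move=> _ [[S Sst Sdec] _] Ph Qh PsP QsP.
have K1h (Rs : 'I_n -> hclass C) :
    (forall i, additive_ih_property (Rs i) /\ indecomposable (Rs i)) ->
    forall i, additive_ih_property (Rs i) /\ Rs i K1.
  by move=> Rh i; have [Ra Ri] := Rh i; split=> //; apply: indecomposable_K1.
have [s sP] := factors_dominated (K1h _ Ph) (K1h _ Qh) PsP QsP Sst Sdec.
have [t tP] := factors_dominated (K1h _ Qh) (K1h _ Ph) QsP PsP Sst Sdec.
(* [Ps i] lies in [Qs (s i)], hence in [Ps (t (s i))]; this is iterated along the cycle of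
   [s * t]. *)
have stP k i X : Ps i X -> Ps (((s * t) ^+ k)%g i) X.
  elim: k => [|k IHk]; first by rewrite expg0 perm1.
  by move=> /IHk/sP/tP; rewrite expgSr !permM.
exists s => i; apply/funext => X; apply/propext; split; first exact: sP.
(* [tP] leads to index [(s * t) i]; the remaining steps, one fewer than the order of [s * t], lead
   back to [i]. *)
move=> /tP; rewrite -permM => /(stP #[(s * t)%g]%g.-1).
by rewrite -permM -expgS prednK ?order_gt0 // expg_order perm1.
Qed.
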